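(* The class $\mathscr{WCG}$ of all weakly compactly generated operators between Banach spaces is a closed operator ideal.
   Context: Banach spaces are over $\mathbb{K}=\mathbb{R}$ or $\mathbb{K}=\mathbb{C}$; an operator is a bounded linear operator between Banach spaces; $\mathscr{B}(E,F)$ is the space of all operators $E\to F$ with the operator norm. A Banach space is weakly compactly generated (WCG) if it contains a weakly compact subset whose linear span is dense. An operator $T\colon E\to F$ is weakly compactly generated if there is a closed subspace $Z$ of $F$ that is a WCG Banach space and satisfies $T(E)\subseteq Z$; $\mathscr{WCG}(E,F)$ is the set of all such operators, and $\mathscr{WCG}$ is the class of all such operators over all pairs $(E,F)$. An operator ideal is a class $\mathscr{J}$ of operators, containing the identity operator of the one-dimensional Banach space, such that $\mathscr{J}(E,F)=\mathscr{B}(E,F)\cap\mathscr{J}$ is a linear subspace of $\mathscr{B}(E,F)$ for all Banach spaces $E,F$, and $RST\in\mathscr{J}(X,Y)$ whenever $T\in\mathscr{B}(X,E)$, $S\in\mathscr{J}(E,F)$, $R\in\mathscr{B}(F,Y)$. It is closed if $\mathscr{J}(E,F)$ is norm-closed in $\mathscr{B}(E,F)$ for all $E,F$. *)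

(* Defs.v *)
From HB Require Import structures.
From mathcomp Require Import all_boot all_order all_algebra.
From mathcomp Require Import all_classical all_reals all_analysis.
From mathcomp Require Import complex.

Set Implicit Arguments.
Unset Strict Implicit.
Unset Printing Implicit Defensive.

Import Order.TTheory GRing.Theory Num.Theory.

Local Open Scope classical_set_scope.
Local Open Scope ring_scope.

Section complex_complete.
Variable R : realType.
Local Notation C := (complex R).

Let normC_split (z : C) :
  `|z| <= (`|complex.Re z|%:C + `|complex.Im z|%:C)%C.
Proof.
case: z => a b /=; rewrite normc_def /= -rmorphD lecR.
rewrite -[leRHS]ger0_norm ?addr_ge0// -sqrtr_sqr ler_wsqrtr//.
rewrite sqrrD !real_normK ?num_real// addrAC lerDl.
by rewrite mulrn_wge0// mulr_ge0.
Qed.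

Let normRe (z : C) : (`|complex.Re z|%:C)%C <= `|z|.
Proof.
case: z => a b /=; rewrite normc_def /= lecR.
by rewrite -sqrtr_sqr ler_wsqrtr// lerDl sqr_ge0.
Qed.

Let normIm (z : C) : (`|complex.Im z|%:C)%C <= `|z|.
Proof.
case: z => a b /=; rewrite normc_def /= lecR.
by rewrite -[`|b|]sqrtr_sqr ler_wsqrtr// lerDr sqr_ge0.
Qed.

Let ReB (x y : C) : complex.Re (x - y) = complex.Re x - complex.Re y.
Proof. by case: x y => [? ?] [? ?]. Qed.

Let ImB (x y : C) : complex.Im (x - y) = complex.Im x - complex.Im y.
Proof. by case: x y => [? ?] [? ?]. Qed.

Let part_cauchy (p : C -> R) (F : set_system C^o) : ProperFilter F ->
  (forall x y, p (x - y) = p x - p y) ->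
  (forall z, (`|p z|%:C)%C <= `|z|) ->
  cauchy F -> cvg ((p @ F) : set_system R^o).
Proof.
move=> FF pB pn /cauchy_ballP Fc; apply: cauchy_cvg; apply/cauchy_ballP => e e0.
have e0C : 0 < (e%:C)%C :> C by rewrite ltcR.
rewrite near_map2.
apply: filterS (Fc _ e0C) => -[x y]; rewrite -!ball_normE /= => xy.
by rewrite -pB -ltcR (le_lt_trans (pn _)).
Qed.

Lemma complex_complete (F : set_system C^o) :
  ProperFilter F -> cauchy F -> cvg F.
Proof.
move=> FF Fc.
have /cvg_ex[/= a Fa] := part_cauchy FF ReB normRe Fc.
have /cvg_ex[/= b Fb] := part_cauchy FF ImB normIm Fc.
apply/cvg_ex; exists (Complex a b : C^o).
apply/cvgrPdist_lt => /= e e0.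
have [r r0 er] : exists2 r : R, 0 < r & e = ((r + r)%:C)%C.
  exists (complex.Re e / 2).
    by move: e0; case: e => x y; rewrite ltcE /= => /andP[_ x0]; rewrite divr_gt0.
  rewrite -splitr; case: e e0 => x y; rewrite ltcE /= => /andP[/eqP -> _].
  by [].
have ra : \forall z \near F, `|a - complex.Re z| < r.
  by move/cvgrPdist_lt : Fa => /(_ _ r0).
have rb : \forall z \near F, `|b - complex.Im z| < r.
  by move/cvgrPdist_lt : Fb => /(_ _ r0).
apply: filterS2 ra rb => z za zb.
rewrite (le_lt_trans (normC_split _))// er -rmorphD ltcR.
by rewrite ReB ImB ltrD.
Qed.

(* Not a canonical instance: C^o is keyed on regular, and the library already
   has a canonical complete structure on R^o for R : realType. *)
Definition complex_banach : completeNormedModType C :=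
  HB.pack C^o (Uniform_isComplete.Build C^o complex_complete).

End complex_complete.

Section bounded_operators.
Context {K : numFieldType}.
Implicit Types E F : normedModType K.

Definition bounded_op {E F} : set (E -> F) :=
  [set T | linear T /\ exists M : K, forall x, `|T x| <= M * `|x|].

(* The supremum is taken in K. When K = R[i], an upper bound of a nonempty set
   of real numbers is real, so this is the usual supremum. *)
Definition opnorm {E F} (T : E -> F) : K :=
  supremum 0 [set `|T x| | x in [set x | `|x| <= 1]].

Definition dual (E : normedModType K) : Type :=
  {f : E -> K^o | bounded_op f}.

Definition weak (E : normedModType K) : topologicalType :=
  sup_topology (fun f : dual E => Topological.on (initial_topology (sval f))).

Definition weakly_compact E (W : set E) : Prop := @compact (weak E) W.

Definition lspan E (W : set E) : set E :=
  [set x | exists n (a : 'I_n -> K) (w : 'I_n -> E),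
    (forall i, W (w i)) /\ x = \sum_(i < n) a i *: w i].

End bounded_operators.

Record closed_subspace (K : numFieldType) (F : normedModType K) := ClosedSubspace {
  subspace_set :> set F;
  subspace0 : subspace_set 0;
  subspaceP : forall (a : K) x y,
    subspace_set x -> subspace_set y -> subspace_set (a *: x + y);
  subspace_closed : closed subspace_set }.

Section closed_subspace_banach.
Context {K : numFieldType}.

Definition subspace_pred (F : normedModType K) (Z : closed_subspace F) :
  {pred F} := fun x => x \in (Z : set F).

Lemma subspace_submod (F : normedModType K) (Z : closed_subspace F) :
  submod_closed (subspace_pred Z).
Proof.
split; first by apply/mem_set; exact: subspace0.
move=> a x y /set_mem Zx /set_mem Zy; apply/mem_set; exact: subspaceP.
Qed.

HB.instance Definition _ (F : normedModType K) (Z : closed_subspace F) :=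
  GRing.isSubmodClosed.Build K F (subspace_pred Z) (subspace_submod Z).

Record subspace_type (F : normedModType K) (Z : closed_subspace F) :=
  SubspaceType { subspace_val : F; subspace_valP : subspace_val \in subspace_pred Z }.

Section instances.
Context {F : normedModType K} (Z : closed_subspace F).
HB.instance Definition _ := [isSub for @subspace_val F Z].
HB.instance Definition _ := [Choice of subspace_type Z by <:].
HB.instance Definition _ := [SubChoice_isSubLmodule of subspace_type Z by <:].

Definition subspace_norm (x : subspace_type Z) : K := `|val x|.

Let normD x y : subspace_norm (x + y) <= subspace_norm x + subspace_norm y.
Proof. by rewrite /subspace_norm raddfD ler_normD. Qed.

Let normZ (l : K) x : subspace_norm (l *: x) = `|l| * subspace_norm x.
Proof. by rewrite /subspace_norm linearZ normrZ. Qed.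

Let norm0 x : subspace_norm x = 0 -> x = 0.
Proof.
by move=> /eqP; rewrite normr_eq0 => /eqP x0; apply: val_inj; rewrite x0 raddf0.
Qed.

HB.instance Definition _ := Lmodule_isNormed.Build K (subspace_type Z)
  normD normZ norm0.
End instances.

Section complete.
Context {F : completeNormedModType K} (Z : closed_subspace F).

Let subspace_complete (G : set_system (subspace_type Z)) :
  ProperFilter G -> cauchy G -> cvg G.
Proof.
move=> GG /cauchy_ballP Gc.
have normE (x y : subspace_type Z) : `|x - y| = `|val x - val y|.
  by rewrite -[LHS]/(`|val (x - y)|) raddfB.
have : cvg ((val @ G) : set_system F).
  apply: cauchy_cvg; apply/cauchy_ballP => e e0.
  rewrite near_map2.
  apply: filterS (Gc _ e0) => -[x y]; rewrite -!ball_normE /=.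
  by rewrite normE.
move=> /cvg_ex[/= l Gl].
have Zl : (Z : set F) l.
  apply: (@closed_cvg _ _ G _ val) Gl => //; first exact: subspace_closed.
  by near=> x; apply: set_mem; exact: valP.
apply/cvg_ex; exists (SubspaceType (mem_set Zl)).
apply/cvgrPdist_lt => /= e e0; move/cvgrPdist_lt : Gl => /(_ _ e0).
by apply: filterS => x; rewrite normE.
Unshelve. all: by end_near. Qed.

HB.instance Definition _ :=
  Uniform_isComplete.Build (subspace_type Z) subspace_complete.
End complete.
End closed_subspace_banach.

Section operator_ideals.
Context {K : numFieldType}.

Definition WCG_space (E : completeNormedModType K) : Prop :=
  exists2 W : set E, weakly_compact W & dense (lspan W).

Definition op_class : Type :=
  forall E F : completeNormedModType K, set (E -> F).

Definition WCG_op : op_class := fun E F =>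
  [set T | bounded_op T /\
    exists2 Z : closed_subspace F, WCG_space (subspace_type Z) &
      range T `<=` Z].

(* K1 stands for the scalar field K seen as a Banach space over itself. It is a
   parameter because not every numFieldType is complete. *)
Record operator_ideal (K1 : completeNormedModType K) (J : op_class) : Prop := {
  ideal_bounded : forall E F, J E F `<=` bounded_op;
  ideal_id : J K1 K1 id;
  ideal0 : forall E F, J E F 0;
  idealD : forall E F S T, J E F S -> J E F T -> J E F (S + T);
  idealZ : forall E F (a : K) T, J E F T -> J E F (a *: T);
  ideal_comp : forall (X E F Y : completeNormedModType K)
    (T : X -> E) (S : E -> F) (U : F -> Y),
    bounded_op T -> J E F S -> bounded_op U -> J X Y (U \o S \o T) }.

Definition norm_closed (J : op_class) : Prop :=
  forall (E F : completeNormedModType K) (T : E -> F), bounded_op T ->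
    (forall e : K, 0 < e -> exists2 S, J E F S & opnorm (T - S) < e) ->
    J E F T.

Definition closed_operator_ideal (K1 : completeNormedModType K)
    (J : op_class) : Prop :=
  operator_ideal K1 J /\ norm_closed J.

End operator_ideals.
Arguments op_class K : clear implicits.
Arguments WCG_op K : clear implicits.

(* Main.v *)
(** If bounded operators [U_n : G_n -> F] start from WCG spaces, then all their
    ranges lie in a single WCG subspace of [F], namely the closed span of these
    ranges: if [W_n] is a weakly compact set with dense span in [G_n], one
    scales pieces of the sets [U_n(W_n)] so that they shrink to 0 and together
    with 0 form a weakly compact set. The ideal properties and norm closedness
    all follow by choosing the [U_n]: inclusions of WCG subspaces for sums and
    norm limits, a restriction of the left factor for composites.
    Instead of invoking the uniform boundedness principle to see that weakly
    compact sets are bounded, each one is cut into countably many bounded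
    weakly compact pieces. *)
Require Import Defs.
From HB Require Import structures.
From mathcomp Require Import all_boot all_order all_algebra.
From mathcomp Require Import all_classical all_reals all_analysis.
From mathcomp Require Import complex.

Set Implicit Arguments.
Unset Strict Implicit.
Unset Printing Implicit Defensive.

Import Order.TTheory GRing.Theory Num.Theory numFieldNormedType.Exports.

Local Open Scope classical_set_scope.
Local Open Scope ring_scope.

(** * Linear maps and bounded operators *)

Section bounded_operators.
Context {K : numFieldType}.
Implicit Types E F G : normedModType K.

Section linear_function.
Context {E F : normedModType K} {T : E -> F}.
Hypothesis Tlin : linear T.

Lemma lin0 : T 0 = 0.
Proof. by have := Tlin (-1) 0 0; rewrite scaler0 addr0 scaleN1r addNr. Qed.

Lemma linD x y : T (x + y) = T x + T y.
Proof. by have := Tlin 1 x y; rewrite !scale1r. Qed.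

Lemma linZ a x : T (a *: x) = a *: T x.
Proof. by have := Tlin a x 0; rewrite !addr0 lin0 addr0. Qed.

Lemma linB x y : T (x - y) = T x - T y.
Proof. by rewrite linD -scaleN1r linZ scaleN1r. Qed.

Lemma lin_sum n (f : 'I_n -> E) : T (\sum_i f i) = \sum_i T (f i).
Proof. by apply: big_morph; [exact: linD|exact: lin0]. Qed.

End linear_function.

(** The bound in [bounded_op] can be negative, or non-real over complex scalars, when [E] is
    trivial. The product of [M] and a norm is nonnegative here, hence equal to its own norm, so the
    norm of [M] serves as well. *)
Lemma bounded_op_ge0 E F (T : E -> F) : bounded_op T ->
  linear T /\ exists2 M : K, 0 <= M & forall x, `|T x| <= M * `|x|.
Proof.
move=> [Tlin [M TM]]; split => //; exists `|M| => // x.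
have Mx0 : 0 <= M * `|x| by exact: le_trans (TM x).
by rewrite (le_trans (TM x))// -[leLHS]ger0_norm// normrM normr_id.
Qed.

Lemma bounded_op_comp E F G (S : F -> G) (T : E -> F) :
  bounded_op S -> bounded_op T -> bounded_op (S \o T).
Proof.
move=> /bounded_op_ge0[Sl [M M0 SM]] [Tl [N TN]]; split.
  by move=> a x y /=; rewrite Tl Sl.
exists (M * N) => x /=.
by rewrite (le_trans (SM _))// -mulrA ler_wpM2l.
Qed.

Lemma bounded_opD E F (S T : E -> F) :
  bounded_op S -> bounded_op T -> bounded_op (S + T).
Proof.
move=> [Sl [M SM]] [Tl [N TN]]; split.
  by move=> a x y; rewrite !fctE Sl Tl scalerDr addrACA.
exists (M + N) => x; rewrite fctE mulrDl.
by rewrite (le_trans (ler_normD _ _))// lerD.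
Qed.

Lemma bounded_opZ E F (a : K) (T : E -> F) :
  bounded_op T -> bounded_op (a *: T).
Proof.
move=> [Tl [N TN]]; split.
  move=> b x y; rewrite -[LHS]/(a *: T (b *: x + y)).
  by rewrite Tl scalerDr !scalerA mulrC -scalerA.
exists (`|a| * N) => x; rewrite -[X in `|X|]/(a *: T x) normrZ.
by rewrite -mulrA ler_wpM2l.
Qed.

Lemma bounded_op0 E F : bounded_op (0 : E -> F).
Proof.
split; first by move=> a x y; rewrite -[LHS]/0 scaler0 addr0.
by exists 0 => x; rewrite normr0 mul0r.
Qed.

Lemma bounded_op_id E : bounded_op (@id E).
Proof. by split => //; exists 1 => x; rewrite mul1r. Qed.

Lemma bounded_op_scale E (a : K) : bounded_op (fun x : E => a *: x).
Proof. exact: (bounded_opZ a (bounded_op_id E)). Qed.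

Lemma bounded_op_continuous E F (T : E -> F) : bounded_op T -> continuous T.
Proof.
move=> /bounded_op_ge0[Tl [M M0 TM]] x; apply/cvgrPdist_lt => e e0.
have eM : 0 < e / (M + 1) by rewrite divr_gt0// ltr_wpDl.
near=> y; rewrite -(linB Tl) (le_lt_trans (TM _))//.
rewrite (@le_lt_trans _ _ ((M + 1) * `|x - y|))//.
  by rewrite ler_wpM2r// lerDl.
rewrite mulrC -ltr_pdivlMr ?ltr_wpDl//.
Unshelve. all: by end_near. Qed.

(** * Weak compactness *)

Lemma weak_cvgP E (F : set_system E) {FF : Filter F} (x : E) :
  F --> (x : weak E) <->
  forall f : E -> K^o, bounded_op f -> f @ F --> f x.
Proof.
rewrite /weak cvg_sup; split => [+ f fb|fF i].
  move=> /(_ (exist _ f fb)) Fx A fA; apply: Fx.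
  exact: (@initial_continuous E K^o f x A fA).
move=> B; rewrite nbhsE => -[U [[V Vop <-] Vx] VB].
rewrite nbhs_filterE; apply: (filterS VB).
by apply: (fF _ (svalP i)); apply: open_nbhs_nbhs.
Qed.

Lemma weakly_compactP E (W : set E) :
  weakly_compact W <->
  forall F : set_system E, UltraFilter F -> F W ->
    exists2 x, W x & forall f : E -> K^o, bounded_op f -> f @ F --> f x.
Proof.
rewrite /weakly_compact compact_ultra; split => + F FU FW.
  by move=> /(_ F FU FW)[x [Wx Fx]]; exists x => //; exact/weak_cvgP.
by move=> /(_ F FU FW)[x Wx Fx]; exists x; split => //=; exact/weak_cvgP.
Qed.

(** Composing a functional on [F] with [T] gives one on [E], so [T] is weak-to-weak continuous. *)
Lemma weakly_compact_image E F (T : E -> F) (W : set E) :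
  bounded_op T -> weakly_compact W -> weakly_compact (T @` W).
Proof.
move=> Tb; apply: (@continuous_compact (weak E) (weak F)).
apply: continuous_subspaceT => x.
have TF : Filter (T @ nbhs (x : weak E)) by exact: fmap_filter.
apply/(@weak_cvgP F) => f fb.
have [+ _] := @weak_cvgP E (nbhs (x : weak E)) _ x.
exact: (fun p => p cvg_id _ (bounded_op_comp fb Tb)).
Qed.

(* The bipolar of the ball of radius r. By Hahn-Banach it is the ball itself,
   but it is weakly closed by construction and its elements are bounded by r on
   functionals of norm at most 1, which is all that is needed. *)
Definition bipolar_ball E (r : K) : set E :=
  [set x | forall (f : E -> K^o) M, linear f -> 0 <= M ->
    (forall y, `|f y| <= M * `|y|) -> `|f x| <= M * r].

Lemma bipolar_ball_norm E (x : E) r : `|x| <= r -> bipolar_ball r x.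
Proof. by move=> xr f M fl M0 fM; rewrite (le_trans (fM x))// ler_wpM2l. Qed.

Lemma bipolar_ball0 E r : 0 <= r -> bipolar_ball r (0 : E).
Proof. by move=> r0; apply: bipolar_ball_norm; rewrite normr0. Qed.

Lemma bipolar_ballW E r s : r <= s -> @bipolar_ball E r `<=` bipolar_ball s.
Proof.
by move=> rs x xr f M fl M0 fM; rewrite (le_trans (xr _ _ fl M0 fM))// ler_wpM2l.
Qed.

Lemma bipolar_ballZ E (a r : K) (x : E) : 0 <= a ->
  bipolar_ball r x -> bipolar_ball (a * r) (a *: x).
Proof.
move=> a0 xr f M fl M0 fM; rewrite (linZ fl) normrZ ger0_norm//.
by rewrite mulrCA ler_wpM2l// xr.
Qed.

Lemma weakly_compactI_bipolar_ball E (W : set E) (r : K) : 0 <= r ->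
  weakly_compact W -> weakly_compact (W `&` bipolar_ball r).
Proof.
move=> r0 /weakly_compactP Wc; apply/weakly_compactP => F FU FW.
have [x Wx Fx] := Wc F FU (filterS (@subIsetl _ _ _) FW).
exists x => //; split => // f M fl M0 fM.
have Mr0 : 0 <= M * r by rewrite mulr_ge0.
(* The order of [K] is partial, but both sides are real. If the bound failed at the weak limit [x],
   some [z] in the ball would have [f z] closer to [f x] than the excess, which is absurd. *)
rewrite real_leNgt ?ger0_real//; apply/negP => Mrx.
have /cvgrPdist_lt/(_ (`|f x| - M * r)) := Fx f (conj fl (ex_intro _ M fM)).
rewrite subr_gt0 => /(_ Mrx) Fz.
have [z [/= zx [_ /(_ f M fl M0 fM) zr]]] := filter_ex (filterI Fz FW).
have : `|f x| < `|f x|; last by rewrite ltxx.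
rewrite -[X in `|X| < _](subrK (f z)) (le_lt_trans (ler_normD _ _))//.
by rewrite -[ltRHS](subrK (M * r)) ltr_leD.
Qed.

(** * Gluing countably many weakly compact sets *)

Section archimedean.
Hypothesis archiK : forall x : K, 0 <= x -> exists n, x <= n%:R.

Lemma archi_inv (e : K) : 0 < e -> exists n, n.+1%:R^-1 < e.
Proof.
move=> e0; have [n en] : exists n, e^-1 <= n%:R.
  by apply: archiK; rewrite invr_ge0 ltW.
exists n; rewrite invf_plt ?posrE ?ltr0n//.
by rewrite (le_lt_trans en)// ltr_nat.
Qed.

(* The members are scaled into bipolar balls of radii tending to 0, so that any
   ultrafilter on the union either lives on one of them or tends weakly to 0. *)
Lemma weakly_compact_bigcup_scaled E (V : nat -> set E) (r : nat -> K) :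
  (forall m, 0 <= r m) -> (forall m, weakly_compact (V m)) ->
  (forall m, V m `<=` bipolar_ball (r m)) ->
  exists W : set E, [/\ weakly_compact W, W `<=` bipolar_ball 1 &
    forall m x, V m x -> exists2 a : K, a != 0 & W (a *: x)].
Proof.
(* This factor brings the radius [r m] down to at most [1/(m+1)]; adding 1 keeps the denominator
   nonzero when [r m] is 0. *)
move=> r0 Vc Vr; pose c m : K := (m.+1%:R * (r m + 1))^-1.
have c0 m : 0 < c m by rewrite invr_gt0 mulr_gt0 ?ltr0n// ltr_wpDl.
have cV m : (fun x => c m *: x) @` V m `<=` bipolar_ball m.+1%:R^-1.
  move=> _ [x Vx <-]; have /bipolar_ballW := bipolar_ballZ (ltW (c0 m)) (Vr _ _ Vx).
  apply; rewrite /c invfM -mulrA ler_piMr ?invr_ge0//.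
  by rewrite mulrC ler_pdivrMr ?ltr_wpDl// mul1r lerDl.
have cVc m : weakly_compact ((fun x => c m *: x) @` V m).
  exact: weakly_compact_image (bounded_op_scale _ _) (Vc m).
pose W := [set 0] `|` \bigcup_m (fun x => c m *: x) @` V m.
exists W; split; last 2 first.
- move=> x [->|[m _ /cV]]; first exact: bipolar_ball0.
  by apply: bipolar_ballW; rewrite invf_le1 ?ler1n.
- move=> m x Vx; exists (c m); first by rewrite gt_eqF.
  by right; exists m => //; exists x.
apply/weakly_compactP => F FU FW.
have [[m Fm]|Fm] := pselect (exists m, F ((fun x => c m *: x) @` V m)).
  have /weakly_compactP/(_ F FU Fm)[x Vx Fx] := cVc m.
  by exists x => //; right; exists m.
exists 0; first by left.
move=> f /bounded_op_ge0[fl [M M0 fM]]; rewrite (lin0 fl).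
apply/cvgrPdist_lt => e e0.
have [n Mn] : exists n, n.+1%:R^-1 < e / (M + 1).
  by apply: archi_inv; rewrite divr_gt0// ltr_wpDl.
(* An ultrafilter containing no scaled piece contains the complement of any finite union of them, so
   only pieces of index at least [n] matter. *)
have FC k : F (\bigcap_(m in [set m | (m < k)%N]) ~` ((fun x => c m *: x) @` V m)).
  elim: k => [|k IH]; first by apply: filterS filterT => x _ m.
  have [Fk|Fk] := in_ultra_setVsetC ((fun x => c k *: x) @` V k) FU.
    by exfalso; apply: Fm; exists k.
  apply: filterS (filterI IH Fk) => x [xk xk'] m /=.
  by rewrite ltnS leq_eqVlt => /orP[/eqP->//|]; exact: xk.
near=> x; rewrite sub0r normrN.
have [->|[m _ Vmx]] : W x by near: x.
  by rewrite (lin0 fl) normr0.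
have nm : (n <= m)%N.
  rewrite leqNgt; apply/negP => mn.
  have : (\bigcap_(m in [set m | (m < n)%N]) ~` ((fun x => c m *: x) @` V m)) x.
    by near: x; exact: FC.
  by move=> /(_ m mn).
have xm := cV _ _ Vmx _ _ fl M0 fM.
rewrite (le_lt_trans xm)// (@le_lt_trans _ _ ((M + 1) * n.+1%:R^-1))//.
  by rewrite ler_pM// ?lerDl// lef_pV2 ?posrE ?ltr0n// ler_nat.
by rewrite mulrC -ltr_pdivlMr ?ltr_wpDl.
Unshelve. all: by end_near. Qed.

(** The pieces of [W] in bipolar balls of integer radius cover [W], each norm being below some
    natural number. The scalar may vary with [x], since only spans matter later. *)
Lemma weakly_compact_bipolar_bounded E (W : set E) : weakly_compact W ->
  exists V : set E, [/\ weakly_compact V, V `<=` bipolar_ball 1 &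
    forall x, W x -> exists2 a : K, a != 0 & V (a *: x)].
Proof.
move=> Wc.
have [m||m x []//|V [Vc V1 WV]] := @weakly_compact_bigcup_scaled E
  (fun m => W `&` bipolar_ball m%:R) (fun m => m%:R).
- exact: ler0n.
- by move=> m; exact: weakly_compactI_bipolar_ball.
exists V; split => // x Wx; have [n xn] := archiK (normr_ge0 x).
by apply: (WV n); split => //; exact: bipolar_ball_norm.
Qed.

(** Gluing needs known radii, so each [W n] is first moved into the bipolar ball of radius 1. *)
Lemma weakly_compact_bigcup E (W : nat -> set E) :
  (forall n, weakly_compact (W n)) ->
  exists2 V : set E, weakly_compact V &
    forall n x, W n x -> exists2 a : K, a != 0 & V (a *: x).
Proof.
move=> Wc; have [V VW] := choice (fun n => weakly_compact_bipolar_bounded (Wc n)).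
have [|m||U [Uc _ VU]] := @weakly_compact_bigcup_scaled E V (fun=> 1).
- by [].
- by have [] := VW m.
- by move=> m; have [] := VW m.
exists U => // n x Wx; have [_ _ /(_ x Wx)[a a0 /VU[b b0]]] := VW n.
by rewrite scalerA; exists (b * a) => //; rewrite mulf_neq0.
Qed.

End archimedean.


(** * Closed linear spans *)

Lemma closure_normP E (A : set E) x :
  closure A x <-> forall e : K, 0 < e -> exists2 y, A y & `|x - y| < e.
Proof.
split=> [Ax e e0|Ax B /nbhs_ballP[e /= e0 eB]].
  have [y [Ay]] := Ax _ (nbhsx_ballx x e e0).
  by rewrite -ball_normE; exists y.
have [y Ay xy] := Ax e e0; exists y; split => //.
by apply: eB; rewrite -ball_normE.
Qed.

Lemma denseP E (A : set E) : dense A <-> forall x, closure A x.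
Proof.
split=> [Ad x B xB|Ad O [x Ox] Oo].
  have [|y [By Ay]] := Ad (interior B) _ (@open_interior _ B).
    by exists x.
  by exists y; split => //; exact: interior_subset.
by rewrite setIC; apply: (Ad x); exact: open_nbhs_nbhs (conj Oo Ox).
Qed.

Lemma sub_lspan E (W : set E) : W `<=` lspan W.
Proof.
move=> x Wx; exists 1%N, (fun=> 1), (fun=> x); split => //.
by rewrite big_ord1 scale1r.
Qed.

Lemma lspan0 E (W : set E) : lspan W 0.
Proof. by exists 0%N, (fun=> 0), (fun=> 0); split => [[]//|]; rewrite big_ord0. Qed.

Lemma lspanP E (W : set E) (a : K) x y :
  lspan W x -> lspan W y -> lspan W (a *: x + y).
Proof.
move=> [m [b [u [Wu ->]]]] [n [c [v [Wv ->]]]].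
exists (m + n)%N, (fun i => match fintype.split i with inl j => a * b j | inr j => c j end),
  (fun i => match fintype.split i with inl j => u j | inr j => v j end).
split; first by move=> i; case: fintype.split.
rewrite big_split_ord scaler_sumr /=; congr (_ + _); apply: eq_bigr => i _.
  by rewrite (unsplitK (inl i)) scalerA.
by rewrite (unsplitK (inr i)).
Qed.

Lemma lspan_sub E (W : set E) (Z : closed_subspace E) :
  W `<=` Z -> lspan W `<=` Z.
Proof.
move=> WZ _ [n [a [w [Ww ->]]]]; elim/big_ind : _ => [|x y Zx Zy|i _].
- exact: subspace0.
- by rewrite -[x]scale1r; exact: subspaceP.
- by rewrite -[_ *: _]addr0; apply: subspaceP; [exact/WZ/Ww|exact: subspace0].
Qed.

Program Definition closed_span E (W : set E) : closed_subspace E :=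
  @ClosedSubspace K E (closure (lspan W)) _ _ _.
Next Obligation. by move=> E W; apply/subset_closure/lspan0. Qed.
Next Obligation.
move=> E W a x y /closure_normP Wx /closure_normP Wy; apply/closure_normP => e e0.
have a1 : 0 < `|a| + 1 by rewrite ltr_wpDl.
have [|x' Wx' xx'] := Wx (e / 2 / (`|a| + 1)); first by rewrite !divr_gt0.
have [|y' Wy' yy'] := Wy (e / 2); first by rewrite divr_gt0.
exists (a *: x' + y'); first exact: lspanP.
rewrite opprD addrACA -scalerBr (splitr e) (le_lt_trans (ler_normD _ _))//.
rewrite ler_ltD// normrZ (@le_trans _ _ ((`|a| + 1) * `|x - x'|))//.
  by rewrite ler_wpM2r// lerDl.
by rewrite mulrC -ler_pdivlMr// ltW.
Qed.
Next Obligation. by move=> E W; exact: closed_closure. Qed.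

Lemma sub_closed_span E (W : set E) : W `<=` closed_span W.
Proof. by move=> x /sub_lspan; exact: subset_closure. Qed.

Lemma closed_span_sub E (W : set E) (Z : closed_subspace E) :
  W `<=` Z -> closed_span W `<=` Z.
Proof.
move=> /lspan_sub WZ; apply: subset_trans (closureS WZ) _.
by rewrite -(closure_id _).1//; exact: subspace_closed.
Qed.

(** The preimage of [Z] under [T] is a closed subspace containing [W]. *)
Lemma bounded_op_closed_span E F (T : E -> F) (W : set E) (Z : closed_subspace F) :
  bounded_op T -> T @` W `<=` Z -> T @` closed_span W `<=` Z.
Proof.
move=> Tb TW; have [Tl _] := Tb.
have [Y YE] : exists Y : closed_subspace E, Y = T @^-1` Z :> set E.
  unshelve eexists (@ClosedSubspace K E (T @^-1` Z) _ _ _) => //.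
  - by rewrite /= (lin0 Tl); exact: subspace0.
  - by move=> a x y Zx Zy; rewrite /= Tl; exact: subspaceP.
  - apply: preimage_closed; last exact: subspace_closed.
    by move=> x _; exact: bounded_op_continuous.
move=> _ [x Wx <-]; rewrite -[_ _]/((T @^-1` Z) x) -YE.
by apply: (closed_span_sub _ Wx) => y Wy; rewrite YE; apply: TW; exists y.
Qed.

End bounded_operators.

(** * Weakly compactly generated spaces and operators *)

Section WCG.
Context {K : numFieldType}.
(** Real and complex scalars share these two properties, so one proof serves both. [supK] ensures
    that [opnorm] is a true supremum and not its default value 0. *)
Hypothesis archiK : forall x : K, 0 <= x -> exists n, x <= n%:R.
Hypothesis supK : forall A : set K, A !=set0 -> (forall a, A a -> 0 <= a) ->
  has_ubound A -> supremums A !=set0.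
Implicit Types E F : completeNormedModType K.

Lemma bounded_op_val F (Z : closed_subspace F) :
  bounded_op (val : subspace_type Z -> F).
Proof. by split; [exact: linearP|exists 1 => x; rewrite mul1r]. Qed.

Lemma WCG_space_span1 E (e : E) :
  (forall x, exists a : K, x = a *: e) -> WCG_space E.
Proof.
move=> eE; exists [set e]; first exact: compact_set1.
apply/denseP => x; have [a ->] := eE x; apply: subset_closure.
by rewrite -[_ *: _]addr0; apply: lspanP; [exact: sub_lspan|exact: lspan0].
Qed.

Lemma WCG_envelope (G : nat -> completeNormedModType K) F
    (U : forall n, G n -> F) :
  (forall n, WCG_space (G n)) -> (forall n, bounded_op (U n)) ->
  exists2 Z : closed_subspace F, WCG_space (subspace_type Z) &
    forall n, range (U n) `<=` Z.
Proof.
move=> /(_ _)/cid2-/all_sig2[W Wc Wd] Ub.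
pose Z := closed_span (\bigcup_n range (U n)).
have UZ n : range (U n) `<=` Z.
  by apply: subset_trans (@sub_closed_span _ _ _) => y Uy; exists n.
exists Z => //.
(* Corestricting to [Z] yields compactness in the weak topology of [Z] itself, without extending
   functionals from [Z] to [F]. *)
pose u n x : subspace_type Z := SubspaceType (mem_set (UZ n _ (imageT (U n) x))).
have ub n : bounded_op (u n).
  have [Ul [M UM]] := Ub n; split; last by exists M.
  by move=> a x y; apply: val_inj; rewrite [RHS]linearP /= Ul.
have [V Vc VW] := weakly_compact_bigcup archiK
  (fun n => weakly_compact_image (ub n) (Wc n)).
exists V => //; apply/denseP => z.
(* Up to nonzero scalars [V] contains every [u n w] with [w] in [W n]. Hence its closed span in [F]
   contains the image under [U n] of the closed span of [W n], which is all of [G n]. *)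
have ZV : Z `<=` closed_span (val @` V).
  apply: closed_span_sub => _ [n _ [x _ <-]].
  apply: (bounded_op_closed_span (W := W n) (Ub n)).
    move=> _ [w Ww <-]; have [|a a0 Va] := VW n (u n w); first by exists w.
    rewrite -[U n w](scalerK a0) -[_ *: _]addr0.
    apply: subspaceP; last exact: subspace0.
    by apply: sub_closed_span; exists (a *: u n w) => //; rewrite linearZ.
  by exists x => //; exact: (denseP _).1 (Wd n) x.
apply/closure_normP => e e0.
have /ZV/closure_normP/(_ e e0)[_ [n [a [w [Vw ->]]]]] := set_mem (valP z).
(* The approximating combination in [F] lifts to [Z] with the same coefficients and the same error,
   as [Z] carries the norm of [F]. *)
have {Vw}/choice[v vV] i : exists v, V v /\ val v = w i.
  by have [v] := Vw i; exists v.
move=> zw; exists (\sum_i a i *: v i).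
  by exists n, a, v; split => // i; have [] := vV i.
rewrite -[`|_|]/(`|val (z - _)|); have [vl _] := bounded_op_val Z.
rewrite (linB vl) (lin_sum vl); under eq_bigr do rewrite (linZ vl) (vV _).2.
by [].
Qed.

Lemma WCG_closed_subspace_bigcup F (Z : nat -> closed_subspace F) :
  (forall n, WCG_space (subspace_type (Z n))) ->
  exists2 Y : closed_subspace F, WCG_space (subspace_type Y) &
    forall n, Z n `<=` Y.
Proof.
move=> Zw; have [Y Yw ZY] := WCG_envelope Zw (fun n => bounded_op_val (Z n)).
exists Y => // n x Zx; apply: (ZY n).
by exists (SubspaceType (mem_set Zx)).
Qed.

(** * Norm limits and the ideal properties *)

Lemma opnorm_bound E F (T : E -> F) x : bounded_op T ->
  `|T x| <= opnorm T * `|x|.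
Proof.
move=> /bounded_op_ge0[Tl [M M0 TM]].
have [->|x0] := eqVneq x 0; first by rewrite (lin0 Tl) !normr0 mulr0.
have nx0 : 0 < `|x| by rewrite normr_gt0.
set A := [set `|T x| | x in [set x | `|x| <= 1]].
have A0 : A !=set0 by exists `|T 0|, 0 => //=; rewrite normr0.
have [||s As] := @supK A A0; first by move=> _ [y _ <-].
  exists M => _ [y /= y1 <-].
  by rewrite (le_trans (TM y))// ler_piMr.
have [uA _] : supremums A (opnorm T).
  rewrite /opnorm /supremum ifF; last exact/negbTE/set0P.
  by apply: xgetPex; exists s.
have : `|T (`|x|^-1 *: x)| <= opnorm T.
  apply: uA; exists (`|x|^-1 *: x) => //=.
  by rewrite normrZ ger0_norm ?invr_ge0// mulVf ?gt_eqF.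
by rewrite (linZ Tl) normrZ ger0_norm ?invr_ge0// mulrC ler_pdivrMr.
Qed.

(** Approximants with errors below [1/(n+1)] all take values in one WCG subspace [Y]; each [T x] is
    a limit of points of [Y], which is closed. *)
Lemma WCG_op_norm_closed : norm_closed (WCG_op K).
Proof.
move=> E F T Tb TS; split => //.
have e0 n : 0 < n.+1%:R^-1 :> K by rewrite invr_gt0 ltr0n.
have /choice[SZ SZP] n : exists SZ : (E -> F) * closed_subspace F,
    [/\ bounded_op SZ.1, opnorm (T - SZ.1) < n.+1%:R^-1,
      WCG_space (subspace_type SZ.2) & range SZ.1 `<=` SZ.2].
  by have [S [Sb [Z Zw SZ]] TSn] := TS _ (e0 n); exists (S, Z).
have [n|Y Yw ZY] := @WCG_closed_subspace_bigcup F (fun n => (SZ n).2).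
  by have [] := SZP n.
exists Y => // _ [x _ <-].
rewrite ((closure_id Y).1 (@subspace_closed _ _ Y)).
apply/closure_normP => e e_gt0.
have x1 : 0 < `|x| + 1 by rewrite ltr_wpDl.
have [n ne] := archi_inv archiK (divr_gt0 e_gt0 x1).
have [Sb TSn _ SY] := SZP n.
exists ((SZ n).1 x); first by apply: (ZY n); apply: SY; exists x.
have TSb : bounded_op (T - (SZ n).1).
  by rewrite -scaleN1r; apply: bounded_opD => //; exact: bounded_opZ.
have := opnorm_bound x TSb; rewrite -[(T - _) x]/(T x - (SZ n).1 x).
move=> /le_lt_trans; apply.
rewrite (@le_lt_trans _ _ (n.+1%:R^-1 * (`|x| + 1)))//.
  rewrite (@le_trans _ _ (n.+1%:R^-1 * `|x|))//.
    by rewrite ler_wpM2r// ltW.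
  by rewrite ler_wpM2l ?lerDl// ltW.
by rewrite -ltr_pdivlMr.
Qed.

(** The vector [e] plays the unit of the scalar field: a space spanned by one vector is WCG, a
    singleton being weakly compact. *)
Lemma WCG_op_ideal (K1 : completeNormedModType K) (e : K1) :
  (forall x, exists a : K, x = a *: e) -> operator_ideal K1 (WCG_op K).
Proof.
move=> /WCG_space_span1 K1w.
(* This is the envelope of a constant sequence of operators. *)
have WCG_from E F (T : E -> F) : bounded_op T -> WCG_space E ->
    exists2 Z : closed_subspace F, WCG_space (subspace_type Z) & range T `<=` Z.
  move=> Tb Ew.
  have [Z Zw TZ] := @WCG_envelope (fun=> E) F (fun=> T) (fun=> Ew) (fun=> Tb).
  by exists Z => //; exact: TZ 0%N.
split.
- by move=> E F T [].
- by split; [exact: bounded_op_id|apply: WCG_from => //; exact: bounded_op_id].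
- move=> E F; split; first exact: bounded_op0.
  (* Some WCG subspace of [F] must be exhibited even for the zero operator; the zero map from [K1]
     supplies one. *)
  have [Z Zw _] := WCG_from K1 F 0 (bounded_op0 _ _) K1w.
  by exists Z => // _ [x _ <-]; exact: subspace0.
- move=> E F S T [Sb [Z1 Z1w SZ1]] [Tb [Z2 Z2w TZ2]].
  split; first exact: bounded_opD.
  (* The two subspaces are presented as the sequence [Z1, Z2, Z2, ...]. *)
  have [n|Y Yw ZY] :=
      @WCG_closed_subspace_bigcup F (fun n => if n is 0%N then Z1 else Z2).
    by case: n.
  exists Y => // _ [x _ <-].
  rewrite -[(S + T) x]/(S x + T x) -[S x]scale1r; apply: subspaceP.
    by apply: (ZY 0%N); apply: SZ1; exists x.
  by apply: (ZY 1%N); apply: TZ2; exists x.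
- move=> E F a T [Tb [Z Zw TZ]]; split; first exact: bounded_opZ.
  exists Z => // _ [x _ <-]; rewrite -[(a *: T) x]/(a *: T x) -[_ *: _]addr0.
  by apply: subspaceP; [apply: TZ; exists x|exact: subspace0].
- move=> X E F Y T S U Tb [Sb [Z Zw SZ]] Ub; split.
    by apply: bounded_op_comp Tb; exact: bounded_op_comp.
  (* The restriction of [U] to the WCG space [Z] has a range containing that of the composite. *)
  have [Z' Z'w UZ'] := WCG_from _ _ _ (bounded_op_comp Ub (bounded_op_val Z)) Zw.
  exists Z' => // _ [x _ <-]; apply: UZ'.
  have Zx : (Z : set F) (S (T x)) by apply: SZ; exists (T x).
  by exists (SubspaceType (mem_set Zx)).
Qed.

End WCG.

(** * Complex scalars *)

Section complex.
Context {R : realType}.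
Local Notation C := (complex R).

Lemma complex_archi (x : C) : 0 <= x -> exists n, x <= n%:R.
Proof.
case: x => a b; rewrite lecE /= => /andP[/eqP -> a0].
exists (Num.Def.archi_bound a); rewrite -(rmorph_nat (@real_complex R)) lecR.
by rewrite ltW// archi_boundP.
Qed.

(** Nonnegative complex numbers are real, so the supremum of the real parts works. An upper bound
    has the same imaginary part as the element [a0] below it, namely 0. *)
Lemma complex_supremums (A : set C) : A !=set0 -> (forall a, A a -> 0 <= a) ->
  has_ubound A -> supremums A !=set0.
Proof.
move=> [a0 Aa0] A_ge0 [M AM].
have AE a : A a -> a = ((complex.Re a)%:C)%C.
  by move=> /A_ge0; case: a => a b; rewrite lecE /= => /andP[/eqP ->].
have ReA : has_sup [set complex.Re a | a in A].
  split; first by exists (complex.Re a0), a0.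
  exists (complex.Re M) => _ [a Aa <-].
  by have := AM _ Aa; rewrite lecE => /andP[].
exists ((sup [set complex.Re a | a in A])%:C)%C; split.
  move=> a Aa; rewrite (AE _ Aa) lecR.
  by apply: ub_le_sup; [case: ReA|exists a].
move=> [y y'] Ay; rewrite lecE /=; apply/andP; split.
  by have := Ay _ Aa0; rewrite (AE _ Aa0) lecE /= => /andP[].
apply: ge_sup; first by case: ReA.
by move=> _ [a Aa <-]; have := Ay _ Aa; rewrite lecE /= => /andP[].
Qed.

End complex.

Theorem theorem2p1 (R : realType) :
  closed_operator_ideal R^o (WCG_op R) /\
  closed_operator_ideal (complex_banach R) (WCG_op (complex R)).
Proof.
have archiR (x : R) : 0 <= x -> exists n, x <= n%:R.
  by move=> x0; exists (Num.Def.archi_bound x); rewrite ltW// archi_boundP.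
have supR (A : set R) : A !=set0 -> (forall a, A a -> 0 <= a) ->
    has_ubound A -> supremums A !=set0.
  move=> A0 _ Aub; exists (sup A); split.
    by move=> a Aa; exact: ub_le_sup.
  by move=> y Ay; exact: ge_sup.
split; split.
- apply: (WCG_op_ideal archiR (e := 1 : R^o)) => x.
  by exists x; rewrite -[RHS]/(x * 1) mulr1.
- exact: WCG_op_norm_closed.
- apply: (WCG_op_ideal (@complex_archi R) (e := (1 : complex R) : complex_banach R)) => x.
  by exists x; rewrite -[RHS]/((x : complex R) * 1) mulr1.
- exact: WCG_op_norm_closed complex_archi complex_supremums.
Qed.
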